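(* Let $(X,d,\mu)$ be a space of homogeneous type without atoms and with $\mu(X)=+\infty$, let $\mathcal{D}$ be a dyadic family on $X$ with an associated Haar system $\mathscr{H}$ and dyadic distance $\delta$, and let $\sigma>0$. Then for every $\lambda>0$ the space $H^{\sigma}_{d,\mu}\cap \mathrm{Ker}\,\Pi_\lambda$ is a space of coercivity for $\mathscr{E}^{d,\mu}_\sigma$. In other words, for every $\lambda>0$ there is a constant $C>0$ depending on $\lambda$ such that for every $u\in H^{\sigma}_{\delta,\mu}$ with $\Pi_\lambda u=0$, $$\mathscr{E}^{d,\mu}_\sigma(u)\ge C\,\|u\|^2_{L^2(X,\mu)}$$ (where $\mathscr{E}^{d,\mu}_\sigma(u)$ may be $+\infty$).
   Context: All functions are real valued. A space of homogeneous type $(X,d,\mu)$ is a set $X$ with a quasi-distance $d$ ($d:X\times X\to[0,\infty)$ symmetric, $d(x,y)=0$ iff $x=y$, and $d(x,y)\le\kappa(d(x,z)+d(z,y))$ for some constant $\kappa\ge1$) and a positive measure $\mu$ on a $\sigma$-algebra containing the balls $B(x,r)=\{y:d(x,y)<r\}$ such that for some constant $A>0$, $0<\mu(B(x,2r))\le A\mu(B(x,r))<\infty$ for all $x\in X$, $r>0$. No atoms means $\mu(\{x\})=0$ for every $x\in X$. Dyadic family: $\mathcal{D}=\bigcup_{j\in\mathbb{Z}}\mathcal{D}_j$ is a family of subsets of $X$ (called cubes) such that: there are $0<\nu<1$ and positive constants $a_1,a_2,a_3$ such that every $Q\in\mathcal{D}_j$ satisfies $a_1\nu^j\le \mathrm{diam}\,Q\le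 a_2\nu^j$ and there are $d$-balls $B_1\subseteq Q\subseteq B_2$ whose radii satisfy $r(B_1)\ge a_3\, r(B_2)$; each cube is a Borel set; each $\mathcal{D}_j$ is a partition of $X$; for each $Q\in\mathcal{D}_{j+1}$ there is exactly one $\widetilde Q\in\mathcal{D}_j$ with $Q\subseteq\widetilde Q$; there is a constant $M$ with $1\le\#\vartheta(Q)\le M$ for every $Q\in\mathcal{D}_j$, where $\vartheta(Q)=\{Q'\in\mathcal{D}_{j+1}:Q'\subseteq Q\}$; any two cubes are disjoint or one contains the other; for every $Q\in\mathcal{D}$ the union of all cubes of $\mathcal{D}$ containing $Q$ is $X$. Haar system: for $Q\in\mathcal{D}$ with $\#\vartheta(Q)>1$, $\mathscr{H}(Q)=\{h_l:l=1,\dots,\#\vartheta(Q)-1\}$ is such that $\{\mu(Q)^{-1/2}\mathcal{X}_Q\}\cup\mathscr{H}(Q)$ is an orthonormal basis (in $L^2(X,\mu)$) of the space of functions vanishing outside $Q$ and constant on each $Q'\in\vartheta(Q)$; $\mathscr{H}=\bigcup_{Q}\mathscr{H}(Q)$, which is an orthonormal basis of $L^2(X,\mu)$. For $h\in\mathscr{H}(Q)$ write $Q(h)=Q$. $\Pi_\lambda$ is the orthogonal projection of $L^2(X,\mu)$ onto the closed linear span of $\{h\in\mathscr{H}:\mu(Q(h))>\lambda\}$. Dyadic distance: $\delta(x,x)=0$ and $\delta(x,y)=\inf\{\mu(Q):Q\in\mathcal{D},\ x\in Q,\ y\in Q\}$ for $x\ne y$. Energies: for $\sigma>0$, $$\mathscr{E}^{d,\mu}_\sigma(u)=\iint_{X\times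 X}\frac{|u(x)-u(y)|^2}{\mu(B(x,d(x,y)))^{1+2\sigma}}\,d\mu(x)d\mu(y),\qquad \mathscr{E}^{\delta,\mu}_\sigma(u)=\iint_{X\times X}\frac{|u(x)-u(y)|^2}{\delta(x,y)^{1+2\sigma}}\,d\mu(x)d\mu(y).$$ $H^\sigma_{d,\mu}$ (respectively $H^\sigma_{\delta,\mu}$) is the space of $u\in L^2(X,\mu)$ with $\mathscr{E}^{d,\mu}_\sigma(u)<\infty$ (respectively $\mathscr{E}^{\delta,\mu}_\sigma(u)<\infty$); $H^\sigma_{d,\mu}$ is normed by $\|u\|_{L^2}+\sqrt{\mathscr{E}^{d,\mu}_\sigma(u)}$. A closed linear subspace $H^{\sigma,0}_{d,\mu}$ of $H^\sigma_{d,\mu}$ is a space of coercivity for $\mathscr{E}^{d,\mu}_\sigma$ if there is a constant $c>0$, depending on the subspace, with $\mathscr{E}^{d,\mu}_\sigma(u)\ge c\|u\|^2_{L^2}$ for every $u$ in it. *)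

(* Defs.v *)
From HB Require Import structures.
From mathcomp Require Import all_boot all_order all_algebra.
From mathcomp Require Import finmap.
From mathcomp Require Import all_classical all_reals all_analysis.

Set Implicit Arguments.
Unset Strict Implicit.
Unset Printing Implicit Defensive.

Import Order.TTheory GRing.Theory Num.Theory.
Import numFieldNormedType.Exports.

Local Open Scope classical_set_scope.
Local Open Scope ring_scope.

Section QuasiMetric.
Context {R : realType} {T : Type}.
Variable d : T -> T -> R.

Definition quasi_distance : Prop :=
  [/\ forall x y, 0 <= d x y,
      forall x y, d x y = d y x,
      forall x y, d x y = 0 <-> x = y &
      exists2 kappa : R, 1 <= kappa &
        forall x y z, d x y <= kappa * (d x z + d z y)].

Definition qball (x : T) (r : R) : set T := [set y | d x y < r].

(* The topology induced by a quasi-distance; its balls need not be open. *)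
Definition qopen : set (set T) :=
  [set U | forall x, U x -> exists2 r : R, 0 < r & qball x r `<=` U].

Definition qborel : set (set T) := <<s qopen >>.

Definition qdiam (Q : set T) : \bar R :=
  ereal_sup [set (d x y)%:E | x in Q & y in Q].

End QuasiMetric.

Section Dyadic.
Context {R : realType} {T : Type}.
Implicit Type D : int -> set (set T).

Definition cubes D : set (set T) := [set Q | exists j : int, D j Q].

(* The children depend on the level [j]: the same set may be a cube of several
   levels, but it has more than one child at no more than one of them (see
   [dyadic_family]). *)
Definition children D (j : int) (Q : set T) : set (set T) :=
  [set Q' | D (j + 1) Q' /\ Q' `<=` Q].

Definition nchildren D (j : int) (Q : set T) : nat :=
  #|` fset_set (children D j Q)|.

Record dyadic_family (d : T -> T -> R) D : Prop := DyadicFamily {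
  dyadic_size : exists nu a1 a2 a3 : R,
    [/\ 0 < nu < 1, 0 < a1, 0 < a2, 0 < a3 &
        forall (j : int) (Q : set T), D j Q ->
          [/\ ((a1 * nu ^ j)%:E <= qdiam d Q)%E,
              (qdiam d Q <= (a2 * nu ^ j)%:E)%E &
              exists (x1 x2 : T) (r1 r2 : R),
                [/\ 0 < r1, 0 < r2, qball d x1 r1 `<=` Q,
                    Q `<=` qball d x2 r2 & a3 * r2 <= r1]]];
  dyadic_borel : forall j Q, D j Q -> qborel d Q;
  dyadic_partition : forall j, partition (D j) id [set: T];
  dyadic_parent : forall j Q, D (j + 1) Q ->
    exists! Q', D j Q' /\ Q `<=` Q';
  dyadic_children : exists M : nat, forall j Q, D j Q ->
    finite_set (children D j Q) /\ (1 <= nchildren D j Q <= M)%N;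
  dyadic_nested : forall Q Q', cubes D Q -> cubes D Q' ->
    [\/ Q `&` Q' = set0, Q `<=` Q' | Q' `<=` Q];
  dyadic_quadrant : forall Q, cubes D Q ->
    \bigcup_(Q' in [set Q' | cubes D Q' /\ Q `<=` Q']) Q' = [set: T]
}.

End Dyadic.

Section HomogeneousType.
Context {R : realType} {disp : measure_display} {X : measurableType disp}.
Variables (d : X -> X -> R) (mu : {measure set X -> \bar R}).

Local Open Scope ereal_scope.

Definition homogeneous_type : Prop :=
  [/\ quasi_distance d,
      forall x r, measurable (qball d x r) &
      exists2 A : R, (0 < A)%R & forall (x : X) (r : R), (0 < r)%R ->
        [/\ 0 < mu (qball d x (2 * r)%R),
            mu (qball d x (2 * r)%R) <= A%:E * mu (qball d x r) &
            A%:E * mu (qball d x r) < +oo]].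

End HomogeneousType.

Section L2.
Context {R : realType} {disp : measure_display} {X : measurableType disp}.
Variable mu : {measure set X -> \bar R}.
Implicit Types u v : X -> R.

(* Elements of L^2 are represented by functions; equality in L^2 is
   [_ = _ %[ae mu]]. *)
Definition L2 : set (X -> R) := [set u | u \in Lfun mu 2%:E].

Definition norm2 u : \bar R := Lnorm mu 2%:E (EFin \o u).

Definition inner u v : R := \int[mu]_x (u x * v x).

Definition lin_span (F : set (X -> R)) : set (X -> R) :=
  [set w | exists (n : nat) (c : 'I_n -> R) (f : 'I_n -> X -> R),
     (forall i, F (f i)) /\ w = (fun x => \sum_(i < n) c i * f i x)].

Definition closed_span (F : set (X -> R)) : set (X -> R) :=
  [set v | L2 v /\ forall eps : R, 0 < eps ->
     exists2 w, lin_span F w & (norm2 (v \- w)%R < eps%:E)%E].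

(* [p] is the orthogonal projection of [u] on [S]: [p] is in [S] and [u - p] is
   orthogonal to [S]. For a closed subspace [S] of L^2 and [u] in L^2 such a [p]
   exists and is unique in L^2, so the default value [u] is not used. *)
Definition orth_proj (S : set (X -> R)) u : X -> R :=
  xget u [set p | S p /\ forall v, S v -> inner (u \- p) v = 0].

Definition orthonormal_basis (V : set (X -> R)) (n : nat) (e : nat -> X -> R) :
    Prop :=
  [/\ forall l, (l < n)%N -> V (e l),
      forall k l, (k < n)%N -> (l < n)%N -> inner (e k) (e l) = (k == l)%:R &
      forall f, V f ->
        exists c : nat -> R, f = (fun x => \sum_(l < n) c l * e l x)].

End L2.

Section Haar.
Context {R : realType} {disp : measure_display} {X : measurableType disp}.
Variables (mu : {measure set X -> \bar R}) (D : int -> set (set X)).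

Definition haar_space (j : int) (Q : set X) : set (X -> R) :=
  [set f | (forall x, ~ Q x -> f x = 0) /\
           forall Q', children D j Q Q' ->
             exists c : R, forall x, Q' x -> f x = c].

(* [h Q l] for 1 <= l <= #children - 1 are the Haar functions of [Q]; index 0 is
   used for the normalized indicator of [Q], and [h Q 0] is ignored. *)
Definition haar_basis (h : set X -> nat -> X -> R) (Q : set X) (l : nat) :
    X -> R :=
  if l is 0 then fun x => (Num.sqrt (fine (mu Q)))^-1 * \1_Q x else h Q l.

Definition haar_system (h : set X -> nat -> X -> R) : Prop :=
  forall (j : int) (Q : set X), D j Q -> (1 < nchildren D j Q)%N ->
    orthonormal_basis mu (haar_space j Q) (nchildren D j Q) (haar_basis h Q).

Definition haar_above (h : set X -> nat -> X -> R) (lambda : R) :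
    set (X -> R) :=
  [set f | exists (j : int) (Q : set X) (l : nat),
     [/\ D j Q, (1 < nchildren D j Q)%N, (1 <= l <= (nchildren D j Q).-1)%N,
         (lambda%:E < mu Q)%E & f = h Q l]].

Definition Pi (h : set X -> nat -> X -> R) (lambda : R) (u : X -> R) : X -> R :=
  orth_proj mu (closed_span mu (haar_above h lambda)) u.

Definition KerPi (h : set X -> nat -> X -> R) (lambda : R) : set (X -> R) :=
  [set u | L2 mu u /\ Pi h lambda u = cst 0 %[ae mu]].

Definition dyadic_dist (x y : X) : \bar R :=
  if x == y then 0%E
  else ereal_inf [set mu Q | Q in [set Q | [/\ cubes D Q, Q x & Q y]]].

End Haar.

Section Energy.
Context {R : realType} {disp : measure_display} {X : measurableType disp}.
Variables (d : X -> X -> R) (mu : {measure set X -> \bar R}).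
Variables (D : int -> set (set X)) (sigma : R).
Implicit Types u : X -> R.

(* On the diagonal both integrands below are 0 / 0 = 0. *)
Definition energy_d u : \bar R :=
  (\int[mu \x mu]_z
     (`|u z.1 - u z.2| ^+ 2 /
        fine (mu (qball d z.1 (d z.1 z.2))) `^ (1 + 2 * sigma))%:E)%E.

Definition energy_delta u : \bar R :=
  (\int[mu \x mu]_z
     (`|u z.1 - u z.2| ^+ 2 /
        fine (dyadic_dist mu D z.1 z.2) `^ (1 + 2 * sigma))%:E)%E.

Definition H_d : set (X -> R) :=
  [set u | L2 mu u /\ (energy_d u < +oo)%E].

Definition H_delta : set (X -> R) :=
  [set u | L2 mu u /\ (energy_delta u < +oo)%E].

Definition norm_H_d u : \bar R := (norm2 mu u + energy_d u `^ 2^-1)%E.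

Definition coercivity_space (V : set (X -> R)) : Prop :=
  [/\ V `<=` H_d,
      V (cst 0) /\ (forall (a : R) u v, V u -> V v -> V (a \*o u \+ v)),
      forall (u_ : nat -> X -> R) u, (forall n, V (u_ n)) -> H_d u ->
        norm_H_d (u_ n \- u) @[n --> \oo] --> 0%E -> V u &
      exists2 c : R, 0 < c &
        forall u, V u -> (c%:E * norm2 mu u ^+ 2 <= energy_d u)%E].

End Energy.

(* Main.v *)
(* Write s = 1 + 2 sigma. If u is orthogonal to the Haar functions of the cubes
   of measure > lambda, then its averages over a cube Q with mu Q > lambda and
   over the children of Q agree. Along the increasing cubes around a point these
   averages tend to 0, because mu X = +oo and u is in L^2; hence every x lies in
   a cube P with mu P <= lambda and \int_P u = 0. Integrating
   (u x - u y)^2 >= (u x)^2 - 2 (u x) (u y) over y in P gives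
     \int_P (u x - u y)^2 / (mu P)^s dy >= lambda^(-2 sigma) (u x)^2,
   while mu (B (x, d x y)) <= C mu P on P x P by doubling. Integrating in x
     yields
   the coercivity inequality.

   The energy integrand need not be measurable, so the comparison and the
   linearity of the finite-energy space go through an equivalent measurable
   integrand, built from the countably many pairs of neighbouring cubes. *)

Require Import Defs.
From HB Require Import structures.
From mathcomp Require Import all_boot all_order all_algebra.
From mathcomp Require Import finmap.
From mathcomp Require Import all_classical all_reals all_analysis.
From mathcomp Require Import measurable_realfun.
From mathcomp Require Import ring lra.

Set Implicit Arguments.
Unset Strict Implicit.
Unset Printing Implicit Defensive.

Import Order.TTheory GRing.Theory Num.Theory.
Import numFieldNormedType.Exports.

Local Open Scope classical_set_scope.
Local Open Scope ring_scope.

(** * Square-integrable functions, inner products and the kernel of an orthogonal projection *)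

Section L2Theory.
Context {R : realType} {disp : measure_display} {X : measurableType disp}.
Variable mu : {measure set X -> \bar R}.
Implicit Types u v w : X -> R.

Lemma L2P u : L2 mu u <->
  measurable_fun setT u /\ (\int[mu]_x ((u x) ^+ 2)%:E < +oo)%E.
Proof.
have E : (\int[mu]_x (`|u x| `^ 2)%:E = \int[mu]_x ((u x) ^+ 2)%:E)%E.
  apply: eq_integral => x _.
  by rewrite powR_mulrn// real_normK// num_real.
have I0 : (0 <= \int[mu]_x ((u x) ^+ 2)%:E)%E.
  by apply: integral_ge0 => x _; rewrite lee_fin sqr_ge0.
split.
  rewrite /L2/= => /andP[/[!inE]/= mu1]; rewrite /finite_norm => fu; split=> //.
  by move: fu; rewrite unlock /= E => /lty_poweRy; apply.
move=> [mu1 fu]; rewrite /L2/= inE; apply/andP; rewrite !inE/=; split => //.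
by rewrite /finite_norm unlock /= E; exact: poweR_lty.
Qed.

Lemma L2_measurable u : L2 mu u -> measurable_fun setT u.
Proof. by move/L2P => []. Qed.

Lemma norm2_sqr u : (norm2 mu u ^+ 2 = \int[mu]_x ((u x) ^+ 2)%:E)%E.
Proof.
have sqrE (y : \bar R) : (0 <= y)%E -> (y ^+ 2 = y `^ 2)%E.
  case: y => [r| |]//=; first by rewrite lee_fin => r0; rewrite powR_mulrn.
  by rewrite mulyy pnatr_eq0.
rewrite /norm2 sqrE ?Lnorm_ge0// poweR_Lnorm//.
apply: eq_integral => x _ /=.
by rewrite powR_mulrn// real_normK// num_real.
Qed.

Lemma L2_mul_integrable u v : L2 mu u -> L2 mu v ->
  mu.-integrable setT (EFin \o (fun x => u x * v x)).
Proof. by move=> hu hv; apply/Lfun1_integrable; exact: Lfun2_mul_Lfun1. Qed.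

Lemma L2_comb (a : R) u v : L2 mu u -> L2 mu v -> L2 mu (a \*o u \+ v).
Proof.
move=> hu hv; apply/L2P; split.
  apply: measurable_funD; last exact: L2_measurable.
  by apply: measurable_funM => //; exact: L2_measurable.
have iu := L2_mul_integrable hu hu; have iv := L2_mul_integrable hv hv.
have iuv := L2_mul_integrable hu hv.
have : mu.-integrable setT (EFin \o (fun x => (a *u x + v x) ^+ 2)).
  have -> : EFin \o (fun x => (a * u x + v x) ^+ 2) =
    (((fun x => ((a ^+ 2)%:E * (EFin \o (fun x => u x * u x)%R) x)) \+
      (fun x => ((2 * a)%:E * (EFin \o (fun x => u x * v x)%R) x))) \+
     (EFin \o (fun x => v x * v x)%R))%E.
    by apply/funext => x /=; rewrite -!EFinM -!EFinD; congr EFin; ring.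
  by apply: integrableD => //; apply: integrableD => //; exact: integrableZl.
move=> /integrableP[_]; under eq_integral do rewrite /= ger0_norm ?sqr_ge0//.
by [].
Qed.

Lemma L2_0 : L2 mu (cst 0).
Proof.
apply/L2P; split => //.
by under eq_integral do rewrite expr0n/=; rewrite integral0.
Qed.

Lemma L2_sub u v : L2 mu u -> L2 mu v -> L2 mu (u \- v).
Proof.
move=> hu hv; have := L2_comb (-1) hv hu.
rewrite [X in L2 _ X -> _](_ : _ = (u \- v))//.
by apply/funext => x /=; ring.
Qed.

Lemma inner_comb (a : R) u v w : L2 mu u -> L2 mu v -> L2 mu w ->
  inner mu (a \*o u \+ v) w = a * inner mu u w + inner mu v w.
Proof.
move=> hu hv hw; rewrite /inner -RintegralZl//; last exact: L2_mul_integrable.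
rewrite -RintegralD//; last 2 first.
- have -> : EFin \o (fun x => a * (u x * w x)) =
    (fun x => (a%:E * (EFin \o (fun x => u x * w x)%R) x)%E).
    by apply/funext => x.
  by apply: integrableZl => //; exact: L2_mul_integrable.
- exact: L2_mul_integrable.
by apply: eq_Rintegral => x _ /=; ring.
Qed.

Lemma innerC u v : inner mu u v = inner mu v u.
Proof. by rewrite /inner; apply: eq_Rintegral => x _; rewrite mulrC. Qed.

Lemma innerB u v w : L2 mu u -> L2 mu v -> L2 mu w ->
  inner mu (u \- v) w = inner mu u w - inner mu v w.
Proof.
move=> hu hv hw; have := inner_comb (-1) hv hu hw.
rewrite mulN1r [RHS]addrC addrC => <-; congr inner.
by apply/funext => x /=; ring.
Qed.

Lemma inner_ae0 u v : u = cst 0 %[ae mu] -> measurable_fun setT u ->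
  measurable_fun setT v -> inner mu u v = 0.
Proof.
move=> u0 mu1 mv; rewrite /inner /Rintegral.
rewrite (@ae_eq_integral _ _ _ mu setT (cst 0%E))// ?integral0//.
- by apply/measurable_EFinP; exact: measurable_funM.
- by apply: filterS u0 => x /= h _; rewrite h//= mul0r.
Qed.

Lemma inner_sqr u : L2 mu u -> ((inner mu u u)%:E = norm2 mu u ^+ 2)%E.
Proof.
move=> hu; rewrite norm2_sqr /inner /Rintegral fineK.
  by apply: eq_integral => x _; rewrite expr2.
by apply: integrable_fin_num => //; exact: L2_mul_integrable.
Qed.

Lemma inner_sqr_eq0 u : L2 mu u -> inner mu u u = 0 -> u = cst 0 %[ae mu].
Proof.
move=> hu /(congr1 (@EFin R)) h0; have /eqP := inner_sqr hu.
rewrite h0 eq_sym expe_eq0/= => /eqP n0.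
have := @Lnorm_eq0_eq0 _ _ _ mu (EFin \o u) 2%:E.
move=> /(_ _ _ n0)[]//.
  by apply/measurable_EFinP; exact: L2_measurable.
move=> N [mN N0 sub]; exists N; split => // x /= h; apply: sub => /= h';
  apply: h.
by move=> _; have [] := h' I.
Qed.

Lemma abs_inner_le u v : L2 mu u -> L2 mu v ->
  (`|inner mu u v|%:E <= norm2 mu u * norm2 mu v)%E.
Proof.
move=> hu hv; have iuv := L2_mul_integrable hu hv.
apply: (@le_trans _ _ ('N[mu]_1 [EFin \o (u \* v)%R])%E); last first.
  apply: hoelder => //; [exact: L2_measurable|exact: L2_measurable|].
  by rewrite [RHS]splitr !div1r.
rewrite Lnorm1 /inner EFin_normr_Rintegral//.
by apply: le_abse_integral => //; case/integrableP: iuv.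
Qed.

(** Replaces the condition on the chosen projection by plain orthogonality. Both ways survive the
    default value of [xget]: if [S] holds no projection, [orth_proj] returns [u] itself, and
    vanishing of [u] gives orthogonality; if [u] is orthogonal to [S], then [cst 0] is a projection,
    so the default does not occur. *)
Lemma orth_proj_eq0 (S : set (X -> R)) u : S `<=` L2 mu -> S (cst 0) ->
  L2 mu u ->
  orth_proj mu S u = cst 0 %[ae mu] <-> (forall v, S v -> inner mu u v = 0).
Proof.
move=> SL S0 hu.
have u0E : (u \- cst 0)%R = u by apply/funext => x /=; rewrite subr0.
split.
- rewrite /orth_proj; case: xgetP => [p -> [Sp pP] p0 v Sv|].
    have := pP _ Sv; rewrite innerB//; [|exact: SL|exact: SL].
    by rewrite (inner_ae0 p0) ?subr0//; apply: L2_measurable; exact: SL.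
  move=> _ u0 v Sv; apply: inner_ae0 => //; apply: L2_measurable => //.
  exact: SL.
- move=> hS; rewrite /orth_proj; case: xgetP => [p -> [Sp pP]|].
    have hp := SL _ Sp.
    apply: inner_sqr_eq0 => //.
    have := pP _ Sp; rewrite innerB// hS// sub0r => /eqP.
    by rewrite oppr_eq0 => /eqP.
  move=> /(_ (cst 0)) []; split => // v Sv; rewrite u0E; exact: hS.
Qed.

Lemma closed_span0 (F : set (X -> R)) : closed_span mu F (cst 0).
Proof.
split; first exact: L2_0.
move=> e e0; exists (cst 0).
  exists 0%N, (fun=> 0), (fun=> cst 0); split; first by case.
  by apply/funext => x; rewrite big_ord0.
rewrite /norm2 [X in Lnorm _ _ X](_ : _ = cst 0%E).
  by rewrite Lnorm0 ?lte_fin.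
by apply/funext => x /=; rewrite subr0.
Qed.

Lemma closed_span_sub (F : set (X -> R)) f : F f -> L2 mu f ->
  closed_span mu F f.
Proof.
move=> Ff hf; split => // e e0; exists f.
  exists 1%N, (fun=> 1), (fun=> f); split => //.
  by apply/funext => x; rewrite big_ord_recl big_ord0 mul1r addr0.
rewrite /norm2 [X in Lnorm _ _ X](_ : _ = cst 0%E).
  by rewrite Lnorm0 ?lte_fin.
by apply/funext => x /=; rewrite subrr.
Qed.

(** The inner product of [u] with [v] is minus that of [u_ n - u] with [v], which Hölder bounds by a
    quantity tending to 0. This gives the closedness of the kernel of the projection. *)
Lemma orth_closed (S : set (X -> R)) (u_ : nat -> X -> R) u : S `<=` L2 mu ->
  (forall n, L2 mu (u_ n)) -> L2 mu u ->
  (forall n v, S v -> inner mu (u_ n) v = 0) ->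
  norm2 mu (u_ n \- u) @[n --> \oo] --> 0%E ->
  forall v, S v -> inner mu u v = 0.
Proof.
move=> SL hu_ hu ort cv v Sv; have hv := SL _ Sv.
have nv : norm2 mu v \is a fin_num.
  rewrite ge0_fin_numE ?Lnorm_ge0//.
  by move: hv; rewrite /L2/= => /andP[_]; rewrite inE.
have le0 n : (`|inner mu u v|%:E <= norm2 mu (u_ n \- u)%R * norm2 mu v)%E.
  have -> : inner mu u v = - inner mu (u_ n \- u) v.
    by rewrite innerB// (ort n)// sub0r opprK.
  by rewrite normrN; apply: abs_inner_le => //; exact: L2_sub.
have cv0 : (norm2 mu (u_ n \- u)%R * norm2 mu v)%E @[n --> \oo] --> 0%E.
  rewrite -(mul0e (norm2 mu v)); apply: cvgeM => //.
    exact: mule_def_fin.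
  exact: cvg_cst.
have : (`|inner mu u v|%:E <= 0)%E.
  rewrite -(cvg_lim _ cv0)//; apply: lime_ge; first by apply/cvg_ex; exists 0%E.
  exact: nearW.
by rewrite lee_fin normr_le0 => /eqP.
Qed.

Lemma inner_cauchy_schwarz u v : L2 mu u -> L2 mu v ->
  inner mu u v ^+ 2 <= inner mu u u * inner mu v v.
Proof.
move=> hu hv; have := abs_inner_le hu hv.
have nf w : L2 mu w -> norm2 mu w \is a fin_num.
  move=> hw; rewrite ge0_fin_numE ?Lnorm_ge0//.
  by move: hw; rewrite /L2/= => /andP[_]; rewrite inE.
have nE w : L2 mu w -> inner mu w w = fine (norm2 mu w) ^+ 2.
  move=> hw; apply: EFin_inj; rewrite inner_sqr// -[in LHS](fineK (nf _ hw)).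
  by rewrite EFin_expe.
rewrite -(fineK (nf _ hu)) -(fineK (nf _ hv)) lee_fin => h.
rewrite !nE// -exprMn -real_normK ?num_real// lerXn2r//= ?nnegrE//.
by rewrite mulr_ge0// fine_ge0// Lnorm_ge0.
Qed.

Lemma inner_sum u n (c : nat -> R) (e : nat -> X -> R) : L2 mu u ->
  (forall l, (l < n)%N -> L2 mu (e l)) ->
  L2 mu (fun x => \sum_(l < n) c l * e l x) /\
  inner mu u (fun x => \sum_(l < n) c l * e l x) =
    \sum_(l < n) c l * inner mu u (e l).
Proof.
move=> hu; elim: n => [|n IH] he.
  rewrite big_ord0 (_ : (fun _ => _) = cst 0); last first.
    by apply/funext => x; rewrite big_ord0.
  split; first exact: L2_0.
  rewrite innerC; apply: inner_ae0 => //; last exact: L2_measurable hu.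
  by apply: nearW.
have [IH1 IH2] := IH (fun l ln => he l (ltnW ln)).
have E : (fun x => \sum_(l < n.+1) c l * e l x) =
    (c n \*o e n \+ (fun x => \sum_(l < n) c l * e l x)).
  by apply/funext => x; rewrite big_ord_recr/= addrC.
rewrite E; split; first exact: L2_comb (he n (ltnSn n)) IH1.
rewrite innerC inner_comb//; last exact: he.
by rewrite big_ord_recr/= innerC [inner _ _ u]innerC IH2 addrC.
Qed.

Lemma innerZr u v (c : R) : L2 mu u -> L2 mu v ->
  inner mu u (fun x => c * v x) = c * inner mu u v.
Proof.
move=> hu hv; rewrite /inner -RintegralZl//; last exact: L2_mul_integrable.
by apply: eq_Rintegral => x _; rewrite mulrCA.
Qed.

Lemma indic_L2 (Q : set X) : measurable Q -> (mu Q < +oo)%E -> L2 mu (\1_Q).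
Proof.
move=> mQ fQ; apply/L2P; split; first exact: measurable_indic.
under eq_integral do rewrite expr2 -[_ * _]/((\1_Q \* \1_Q) _) -indicI setIid.
by rewrite integral_indic// setIT.
Qed.

Lemma inner_indic (P Q : set X) : measurable P -> measurable Q ->
  inner mu (\1_P) (\1_Q) = fine (mu (P `&` Q)).
Proof.
move=> mP mQ; rewrite /inner /Rintegral; congr fine.
under eq_integral do rewrite -[_ * _]/((\1_P \* \1_Q) _) -indicI.
by rewrite integral_indic ?setIT//; exact: measurableI.
Qed.

End L2Theory.

(** The index type is arbitrary, so the union is regrouped along the fibres of an injection of [A]
    into [nat]; each fibre is empty or a single index. *)
Lemma countable_bigcup_measurable (disp : measure_display)
    (X : measurableType disp) (I : Type) (A : set I) (F : I -> set X) :
  countable A -> (forall i, A i -> measurable (F i)) ->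
  measurable (\bigcup_(i in A) F i).
Proof.
move=> cA mF.
have [f inj] : exists f : I -> nat, {in A &, injective f}.
  exact/countable_injP.
have -> : \bigcup_(i in A) F i =
    \bigcup_n (\bigcup_(i in [set i | A i /\ f i = n]) F i).
  apply/seteqP; split=> [x [i Ai Fx]|x [n _ [i [Ai _] Fx]]]; last by exists i.
  by exists (f i) => //; exists i.
apply: bigcupT_measurable => n.
have [[i [Ai fi]]|h] := pselect (exists i, A i /\ f i = n).
  rewrite (_ : \bigcup_(_ in _) _ = F i); first exact: mF.
  apply/seteqP; split=> [x [k [Ak fk]]|x Fx]; last by exists i.
  by rewrite (inj _ _ _ _ (etrans fk (esym fi))) ?inE.
rewrite (_ : \bigcup_(_ in _) _ = set0) //.
by apply/seteqP; split=> // x [k hk _]; apply: h; exists k.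
Qed.

(** * Combinatorics of the cubes: ancestors, descendants and countability *)

Section DyadicCubes.
Context {R : realType} {T : Type}.
Variables (d : T -> T -> R) (D : int -> set (set T)).
Hypothesis dyadic : dyadic_family d D.

Lemma cube_exists (j : int) (x : T) : exists Q, D j Q /\ Q x.
Proof.
have [cov _ _] := dyadic_partition dyadic j.
have : [set: T] x by [].
by rewrite -cov => -[Q DQ Qx]; exists Q.
Qed.

(** The cube of level [j] around [x]; as each level is a partition, the default [set0] is never
    reached ([cubeP]). Smaller levels carry larger cubes. *)
Definition cube (j : int) (x : T) : set T :=
  xget set0 [set Q | D j Q /\ Q x].

Lemma cubeP j x : D j (cube j x) /\ cube j x x.
Proof.
by rewrite /cube; case: xgetP => [Q ->//|];
  have [Q hQ] := cube_exists j x => /(_ Q).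
Qed.

Lemma cubeD j x : D j (cube j x). Proof. by case: (cubeP j x). Qed.

Lemma cube_self j x : cube j x x. Proof. by case: (cubeP j x). Qed.

Lemma cubeE j Q x : D j Q -> Q x -> Q = cube j x.
Proof.
move=> DQ Qx; have [_ tr _] := dyadic_partition dyadic j.
apply: (tr _ _ DQ (cubeD j x)); exists x; split => //; exact: cube_self.
Qed.

Lemma cube_nonempty j Q : D j Q -> exists x, Q x.
Proof. by have [_ _ ne] := dyadic_partition dyadic j => /ne. Qed.

Lemma cube_eq j x y : cube j x y -> cube j y = cube j x.
Proof. by move=> h; rewrite (cubeE (cubeD j x) h). Qed.

Lemma cube_succ j x : cube (j + 1) x `<=` cube j x.
Proof.
have [Q [[DQ sub] _]] := dyadic_parent dyadic (cubeD (j + 1) x).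
by rewrite -(cubeE DQ (sub _ (cube_self _ _))).
Qed.

Lemma cube_add j (n : nat) x : cube (j + n%:Z) x `<=` cube j x.
Proof.
elim: n => [|n IH]; first by rewrite addr0.
apply: subset_trans IH; rewrite -addn1 PoszD addrA; exact: cube_succ.
Qed.

Lemma cube_le i j x : i <= j -> cube j x `<=` cube i x.
Proof.
move=> ij; have -> : j = i + `|j - i|%N%:Z.
  by rewrite gez0_abs ?subr_ge0// addrCA subrr addr0.
exact: cube_add.
Qed.

(** The quadrant axiom yields a cube containing [cube j x] and [y], of some level [i]. If [i] is at
    most [j] it is the required ancestor; otherwise it also lies inside [cube j x], and [n = 0]
    works. *)
Lemma cube_quadrant x y j : exists n : nat, cube (j - n%:Z) x y.
Proof.
have q := dyadic_quadrant dyadic (ex_intro _ j (cubeD j x)).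
have : [set: T] y by [].
rewrite -q => -[Q [[i Di] sub] Qy].
have QE : Q = cube i x by apply: cubeE => //; apply: sub; exact: cube_self.
have [ij|ji] := lerP i j.
  exists `|j - i|%N.
  by rewrite gez0_abs ?subr_ge0// opprB addrC subrK -QE.
exists 0%N; rewrite subr0; apply: (@cube_le j i) => //; first exact: ltW.
by rewrite -QE.
Qed.

Lemma descendants_finite i Q (n : nat) : D i Q ->
  finite_set [set P | D (i + n%:Z) P /\ P `<=` Q].
Proof.
move=> DQ; elim: n => [|n IH].
  apply: (sub_finite_set _ (finite_set1 Q)) => P [].
  rewrite addr0 => DP PQ /=; have [x Px] := cube_nonempty DP.
  by rewrite (cubeE DP Px) (cubeE DQ (PQ _ Px)).
apply: (@sub_finite_set _ _
  (\bigcup_(P in [set P | D (i + n%:Z) P /\ P `<=` Q]) children D (i + n%:Z)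
    P)).
  move=> P [DP PQ]; have [x Px] := cube_nonempty DP.
  have E : i + n.+1%:Z = i + n%:Z + 1 by rewrite -addn1 PoszD addrA.
  rewrite E in DP; exists (cube (i + n%:Z) x).
    split; first exact: cubeD.
    by rewrite (cubeE DQ (PQ _ Px)); exact: cube_add.
  by split => //; rewrite (cubeE DP Px); exact: cube_succ.
apply: bigcup_finite => // P [DP _].
by have [M hM] := dyadic_children dyadic; have [] := hM _ _ DP.
Qed.

(** Every cube of level [j] descends from some ancestor of one fixed point [x0], and each of these
    countably many ancestors has finitely many descendants of level [j]. *)
Lemma countable_cubes j : countable (D j).
Proof.
have [[x0]|noT] := pselect (exists x : T, True); last first.
  apply: (@sub_countable _ _ _ (@set0 (set T))); last exact: countable0.
  apply: subset_card_le => Q /cube_nonempty[x _]; apply: noT; by exists x.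
move=> _.
apply: (@sub_countable _ _ _ (\bigcup_n
  [set P | D ((j - n%:Z) + n%:Z) P /\ P `<=` cube (j - n%:Z) x0])); last first.
  apply: bigcup_countable => // n _; apply: finite_set_countable.
  apply: descendants_finite; exact: cubeD.
apply: subset_card_le => Q DQ; have [x Qx] := cube_nonempty DQ.
have [n nx] := cube_quadrant x0 x j.
exists n => //; split; first by rewrite subrK.
rewrite (cubeE DQ Qx) -(cube_eq nx); apply: cube_le.
by rewrite gerBl.
Qed.

Lemma cube_child_cover j Q x : D j Q -> Q x -> children D j Q (cube (j + 1) x).
Proof.
by move=> DQ Qx; split; [exact: cubeD|rewrite (cubeE DQ Qx); exact: cube_succ].
Qed.

End DyadicCubes.

(** * Size of the cubes compared with powers of [nu] *)

Section CubeScales.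
Context {R : realType} {T : Type}.
Variables (d : T -> T -> R) (D : int -> set (set T)).

Record cube_scales (nu a b : R) : Prop := CubeScales {
  scale_nu : 0 < nu < 1;
  scale_a : 0 < a;
  scale_b : 0 < b;
  scale_diam : forall j Q x y, D j Q -> Q x -> Q y -> d x y <= a * nu ^ j;
  scale_ball : forall j Q, D j Q -> exists z, qball d z (b * nu ^ j) `<=` Q
}.

Lemma dyadic_cube_scales : quasi_distance d -> dyadic_family d D ->
  exists nu a b, cube_scales nu a b.
Proof.
move=> [d0 dC d1 [k k1 dT]] dy.
have [nu [a1 [a2 [a3 [/andP[nu0 nu1] a10 a20 a30 H]]]]] := dyadic_size dy.
have k0 : 0 < k by rewrite (lt_le_trans ltr01).
(* A cube inside a ball of radius [r2] has diameter at most [2 * k * r2]; the lower bound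
   [a1 * nu ^ j] on the diameter thus bounds [r2], and then [r1 >= a3 * r2], from below. *)
exists nu, a2, (a3 * a1 / (2 * k)); split => //.
- by rewrite nu0.
- by rewrite divr_gt0// mulr_gt0.
- move=> j Q x y DQ Qx Qy; have [_ up _] := H _ _ DQ.
  rewrite -lee_fin; apply: le_trans up; apply: ereal_sup_ubound.
  by exists x => //; exists y.
- move=> j Q DQ; have [lo _ [x1 [x2 [r1 [r2 [r10 r20 s1 s2 r12]]]]]] := H _ _
  DQ.
  exists x1; apply: subset_trans s1 => y; rewrite /qball/= => h.
  apply: (lt_le_trans h); apply: le_trans r12.
  have : a1 * nu ^ j <= 2 * k * r2.
    rewrite -lee_fin; apply: (le_trans lo);
      apply: ge_ereal_sup => _ [x Qx] [z Qz] <-.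
    rewrite lee_fin; apply: (le_trans (dT _ _ x2)).
    rewrite (mulrC 2) -mulrA ler_pM2l//.
    have := s2 _ Qx; have := s2 _ Qz; rewrite /qball/= (dC x) => h1 h2.
    lra.
  rewrite (_ : a3 * a1 / (2 * k) * nu ^ j = a3 * (a1 * nu ^ j / (2 * k)));
    last first.
    by ring.
  by rewrite ler_pM2l// ler_pdivrMr ?mulr_gt0// [leRHS]mulrC.
Qed.

Lemma scale_exists (nu r : R) : 0 < nu < 1 -> 0 < r ->
  exists j : int, nu ^ (j + 1) <= r < nu ^ j.
Proof.
move=> /andP[nu0 nu1] r0.
pose t := ln r / ln nu.
have lnu : ln nu < 0 by rewrite ln_lt0// nu0.
have rE : r = nu `^ t.
  by rewrite /powR gt_eqF// /t divfK ?lt_eqF// lnK// posrE.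
(* [t] is the logarithm of [r] in base [nu]; since [nu < 1], the inequalities between [t] and its
   ceiling are reversed. *)
exists (Num.ceil t - 1); rewrite subrK -!powR_intmul ?(ltW nu0)//.
have /andP[h1 h2] := ceil_itv t.
rewrite rE; apply/andP; split.
  by apply: ger_powR => //; rewrite nu0 ltW.
rewrite /powR gt_eqF// ltr_expR ltr_nM2r//.
Qed.

End CubeScales.

(** * Measurability of the cubes, and their measure compared with that of balls *)

Section CubeMeasure.
Context {R : realType} {disp : measure_display} {X : measurableType disp}.
Variables (d : X -> X -> R) (mu : {measure set X -> \bar R}).
Variables (D : int -> set (set X)) (nu a b : R).
Hypotheses (homogeneous : homogeneous_type d mu) (dyadic : dyadic_family d D).
Hypothesis scales : cube_scales d D nu a b.
Local Notation B := (qball d).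
Local Notation cube := (cube D).

Let nu0 : 0 < nu. Proof. by case/andP: (scale_nu scales). Qed.
Let nu1 : nu < 1. Proof. by case/andP: (scale_nu scales). Qed.
Let a0 : 0 < a. Proof. exact: scale_a scales. Qed.
Let b0 : 0 < b. Proof. exact: scale_b scales. Qed.
Let nuj0 j : 0 < nu ^ j. Proof. exact: exprz_gt0. Qed.

Lemma qballS x r s : r <= s -> B x r `<=` B x s.
Proof. by move=> rs y; rewrite /qball/= => h; exact: lt_le_trans rs. Qed.

Lemma qball_measurable x r : measurable (B x r).
Proof. by case: homogeneous. Qed.

Lemma qball_measure_bounds x r : 0 < r -> (0 < mu (B x r) < +oo)%E.
Proof.
move=> r0; have [_ _ [A A0 H]] := homogeneous.
apply/andP; split.
  have r20 : 0 < r / 2 by rewrite divr_gt0.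
  by have [] := H x _ r20; rewrite mulrCA mulfV// mulr1.
have [_ _] := H x _ r0.
case: (mu (B x r)) (measure_ge0 mu (B x r)) => [s _ _|_|//]; first exact: ltry.
by rewrite gt0_muley// lte_fin.
Qed.

Lemma doubling (K : R) : exists2 C : R, 0 < C &
  forall x r, 0 < r -> (mu (B x (K * r)) <= C%:E * mu (B x r))%E.
Proof.
have [_ _ [A A0 H]] := homogeneous.
have iter n x r : 0 < r -> (mu (B x (2 ^+ n * r)) <= (A ^+ n)%:E * mu (B x
  r))%E.
  move=> r0; elim: n => [|n IH]; first by rewrite !expr0 mul1r mul1e.
  have p0 : 0 < 2 ^+ n * r by rewrite mulr_gt0// exprn_gt0.
  have [_ h _] := H x _ p0.
  rewrite exprS -mulrA; apply: (le_trans h).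
  by rewrite exprS EFinM -muleA lee_pmul2l// lte_fin.
(* Doubling is iterated [n = Num.bound |K|] times, which is enough because [|K| <= 2 ^ n]. *)
exists (A ^+ Num.bound `|K|); first exact: exprn_gt0.
move=> x r r0; apply: le_trans (iter _ _ _ r0).
apply: le_measure; rewrite ?inE; [exact: qball_measurable..|].
apply: qballS; rewrite ler_pM2r//; apply: (le_trans (ler_norm _)).
by apply/ltW/upper_nthrootP.
Qed.

(** Only balls are assumed measurable, so [U] is written as a countable union of balls: one
    candidate for each cube, centred at a chosen point of it and kept if it lies in [U]. The radius
    [2 * a * nu ^ j] exceeds the diameter of the cube, so the ball covers the cube. *)
Lemma qopen_measurable (U : set X) : qopen d U -> measurable U.
Proof.
move=> oU; have [[x0 Ux0]|] := pselect (exists x, U x); last first.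
  by move=> h; rewrite (_ : U = set0)//; apply/seteqP; split=> // x Ux;
    apply: h; exists x.
have [[d0 dC d1 [k k1 dT]] _ _] := homogeneous.
have k0 : 0 < k by rewrite (lt_le_trans ltr01).
pose p (Q : set X) := xget x0 Q.
have pP j Q : D j Q -> Q (p Q).
  by move=> /(cube_nonempty dyadic)[x Qx]; rewrite /p; case: xgetP => // /(_ x).
pose ball j Q := B (p Q) (2 * a * nu ^ j).
rewrite (_ : U = \bigcup_(j : int) \bigcup_(Q in [set Q | D j Q /\ ball j Q
  `<=` U]) ball j Q).
  apply: countable_bigcup_measurable => // j _.
  apply: countable_bigcup_measurable.
    apply: (sub_countable _ (countable_cubes dyadic j)).
    by apply: subset_card_le => Q [].
  by move=> Q _; exact: qball_measurable.
apply/seteqP; split; last by move=> x [j _] [Q [_ sub]] /sub.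
move=> x Ux; have [r r0 rU] := oU _ Ux.
(* Within this scale a point of the ball around [p Q] is at distance less than
   [k * (a + 2 * a) * nu ^ i <= r] from [x]. *)
have [j /andP[jr _]] : exists j : int, nu ^ (j + 1) <= r / (3 * k * a) < nu ^ j.
  by apply: scale_exists; rewrite ?nu0// divr_gt0// !mulr_gt0.
move: jr; rewrite ler_pdivlMr ?mulr_gt0// => jr.
set i := j + 1 in jr *.
have Qx := cube_self dyadic i x; have DQ := cubeD dyadic i x.
have Qp := pP _ _ DQ.
have pa := mulr_gt0 a0 (nuj0 i).
exists i => //; exists (cube i x); last first.
  rewrite /ball /qball/=; apply: (le_lt_trans (scale_diam scales DQ Qp Qx)).
  by rewrite -mulrA; lra.
split => // y By; apply: rU; rewrite /qball/=.
apply: (le_lt_trans (dT _ _ (p (cube i x)))).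
have h1 := scale_diam scales DQ Qx Qp.
move: By; rewrite /ball /qball/= => h2.
apply: lt_le_trans jr; rewrite (_ : nu ^ i * _ = k * (3 * (a * nu ^ i)));
  last by ring.
rewrite ltr_pM2l//; rewrite -mulrA in h2; lra.
Qed.

Lemma cube_measurable j Q : D j Q -> measurable Q.
Proof.
move=> /(dyadic_borel dyadic); apply: smallest_sub.
  exact: sigma_algebra_measurable.
exact: qopen_measurable.
Qed.

Lemma cube_sub_qball j Q x : D j Q -> Q x -> Q `<=` B x (2 * a * nu ^ j).
Proof.
move=> DQ Qx y Qy; rewrite /qball/=;
  apply: (le_lt_trans (scale_diam scales DQ Qx Qy)).
by rewrite -mulrA; have := mulr_gt0 a0 (nuj0 j); lra.
Qed.

Lemma cube_measure_bounds j Q : D j Q -> (0 < mu Q < +oo)%E.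
Proof.
move=> DQ; have mQ := cube_measurable DQ.
have [z zQ] := scale_ball scales DQ; have [x Qx] := cube_nonempty dyadic DQ.
have /andP[h1 _] := @qball_measure_bounds z (b * nu ^ j) (mulr_gt0 b0 (nuj0 j)).
have r0 : 0 < 2 * a * nu ^ j by rewrite !mulr_gt0.
have /andP[_ h2] := @qball_measure_bounds x _ r0.
apply/andP; split.
  apply: (lt_le_trans h1); apply: le_measure => //; rewrite inE//.
  exact: qball_measurable.
apply: le_lt_trans h2; apply: le_measure; rewrite ?inE//.
  exact: qball_measurable.
exact: cube_sub_qball.
Qed.

Lemma cube_measure_fin j Q : D j Q -> mu Q \is a fin_num.
Proof. by move=> /cube_measure_bounds/andP[h1 h2]; rewrite ge0_fin_numE. Qed.

Lemma fine_cube_gt0 j Q : D j Q -> 0 < fine (mu Q).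
Proof. by move=> /cube_measure_bounds; exact: fine_gt0. Qed.

Lemma qball_le_cube (K : R) : exists2 C : R, 0 < C &
  forall j Q x, D j Q -> Q x -> (mu (B x (K * nu ^ j)) <= C%:E * mu Q)%E.
Proof.
have [[d0 dC d1 [k k1 dT]] _ _] := homogeneous.
have k0 : 0 < k by rewrite (lt_le_trans ltr01).
(* The ball around [x] lies in the ball of radius [k * (a + K) * nu ^ j] around the centre [z] of
   the inner ball of [Q], whose radius is [b * nu ^ j]. *)
have [C C0 H] := doubling (k * (a + K) / b).
exists C => // j Q x DQ Qx; have [z zQ] := scale_ball scales DQ.
have Qz : Q z.
  by apply: zQ; rewrite /qball/= (d1 z z).2// mulr_gt0.
have r0 : 0 < b * nu ^ j by rewrite mulr_gt0.
apply: (@le_trans _ _ (mu (B z (k * (a + K) / b * (b * nu ^ j))))).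
  apply: le_measure; rewrite ?inE; [exact: qball_measurable..|].
  move=> y; rewrite /qball/= => h.
  rewrite mulrA divfK ?gt_eqF//; apply: (le_lt_trans (dT _ _ x)).
  rewrite -mulrA ltr_pM2l// mulrDl.
  have := scale_diam scales DQ Qz Qx; lra.
apply: (le_trans (H _ _ r0)); rewrite lee_pmul2l ?lte_fin//.
apply: le_measure; rewrite ?inE//; first exact: qball_measurable.
exact: cube_measurable DQ.
Qed.

Lemma cube_le_qball (K : R) : exists2 C : R, 0 < C &
  forall j Q x r, D j Q -> Q x -> 0 < r -> nu ^ j <= K * r ->
    (mu Q <= C%:E * mu (B x r))%E.
Proof.
have [C C0 H] := doubling (2 * a * K).
exists C => // j Q x r DQ Qx r0 jr.
apply: le_trans (H x _ r0).
apply: le_measure; rewrite ?inE;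
  [exact: cube_measurable DQ|exact: qball_measurable|].
apply: (subset_trans (cube_sub_qball DQ Qx)); apply: qballS.
by rewrite -[leRHS]mulrA ler_pM2l// mulr_gt0.
Qed.

Lemma bigcap_cube x : \bigcap_(n : nat) cube n%:Z x = [set x].
Proof.
have [[d0 dC d1 _] _ _] := homogeneous.
apply/seteqP; split; last by move=> y -> n _; exact: (cube_self dyadic).
move=> y h; apply/esym/(d1 x y).1/eqP; rewrite eq_le d0 andbT.
have cv : (a * nu ^+ n : R) @[n --> \oo] --> 0.
  rewrite -[X in _ --> X](mulr0 a); apply: cvgMr; apply: cvg_expr.
  by rewrite gtr0_norm.
rewrite -(cvg_lim _ cv)//; apply: limr_ge; first by apply/cvg_ex; exists 0.
apply: nearW => n; have := scale_diam scales (cubeD dyadic n%:Z x) (cube_self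
  dyadic n%:Z x) (h n I).
by [].
Qed.

(** Continuity from above: the cubes around [x] have finite measure and shrink to the null set
    [[set x]]. *)
Lemma cube_measure_small (x : X) (lambda : R) : mu [set x] = 0%E ->
  0 < lambda -> exists n : nat, (mu (cube n%:Z x) <= lambda%:E)%E.
Proof.
move=> x0 l0.
have mc n : measurable (cube n%:Z x) by exact: cube_measurable (cubeD dyadic
  n%:Z x).
have := @nonincreasing_cvg_mu _ _ _ mu (fun n => cube n%:Z x).
move=> /(_ _ mc) h.
have {h}: mu \o (fun n => cube n%:Z x) @ \oo --> mu (\bigcap_n cube n%:Z x).
  apply: h.
  - by have /andP[] := cube_measure_bounds (cubeD dyadic 0%:Z x).
  - exact: bigcap_measurable.
  - move=> m n mn; apply/subsetPset; apply: (cube_le dyadic).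
    by rewrite lez_nat.
rewrite bigcap_cube x0 => /fine_cvgP[_ cv].
have /cvgrPdist_le /(_ _ l0)[N _ HN] := cv.
exists N; have := HN N (leqnn N); rewrite /= sub0r normrN.
have fin := cube_measure_fin (cubeD dyadic N%:Z x).
by rewrite ger0_norm ?fine_ge0// -lee_fin fineK.
Qed.

(** Continuity from below: the ancestors of [x] increase to the whole space. *)
Lemma cube_measure_large (x : X) (j : int) (M : R) : mu [set: X] = +oo%E ->
  exists n : nat, (M%:E < mu (cube (j - n%:Z) x))%E.
Proof.
move=> xoo; apply: contrapT => /forallNP h.
have mc n : measurable (cube (j - n%:Z) x).
  exact: cube_measurable (cubeD dyadic (j - n%:Z) x).
have cv : mu \o (fun n => cube (j - n%:Z) x) @ \oo --> mu (\bigcup_n cube (j -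
  n%:Z) x).
  apply: nondecreasing_cvg_mu => //; first exact: bigcupT_measurable.
  move=> m n mn; apply/subsetPset; apply: (cube_le dyadic).
  by rewrite lerD2l lerN2 lez_nat.
have E : \bigcup_n cube (j - n%:Z) x = [set: X].
  apply/seteqP; split => // y _; have [n hn] := cube_quadrant dyadic x y j.
  by exists n.
rewrite E xoo in cv.
have : (+oo <= M%:E)%E.
  rewrite -(cvg_lim _ cv)//; apply: lime_le; first by apply/cvg_ex;
    exists +oo%E.
  by apply: nearW => n /=; rewrite leNgt; apply/negP; exact: h.
by rewrite leye_eq.
Qed.

(** Going up from a small cube of level [N], let [m] be the first number of steps at which the
    measure exceeds [lambda]. The cube one step before is still small, and all coarser ones are
    large by monotonicity. *)
Lemma stopping_cube (x : X) (lambda : R) : mu [set x] = 0%E ->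
  mu [set: X] = +oo%E -> 0 < lambda ->
  exists j : int, (mu (cube j x) <= lambda%:E)%E /\
    forall n : nat, (lambda%:E < mu (cube (j - n.+1%:Z) x))%E.
Proof.
move=> x0 xoo l0; have [N hN] := cube_measure_small x0 l0.
pose P (n : nat) := (lambda%:E < mu (cube (N%:Z - n%:Z) x))%E.
have exP : exists n, P n := cube_measure_large x N%:Z lambda xoo.
have [m Pm minm] := ex_minnP exP.
have m0 : (0 < m)%N.
  by case: m Pm {minm} => //; rewrite /P subr0 ltNge hN.
exists (N%:Z - m.-1%:Z); split.
  rewrite leNgt; apply/negP => h; have := minm _ h.
  by rewrite -ltnS prednK// ltnn.
move=> n; apply: (lt_le_trans Pm); apply: le_measure;
  rewrite ?inE; [exact: cube_measurable (cubeD dyadic _ x)..|].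
apply: (cube_le dyadic).
have -> : N%:Z - m%:Z = N%:Z - m.-1%:Z - 1.
  by rewrite -[in LHS](prednK m0) -addn1 PoszD opprD addrA.
by rewrite lerD2l lerN2 lez_nat.
Qed.

(** Needed for the product measure and Tonelli: the ancestors of a point exhaust the space and have
    finite measure. *)
Lemma cube_sigma_finite (x : X) : sigma_finite [set: X] mu.
Proof.
exists (fun n => cube (0 - n%:Z) x).
  apply/seteqP; split => // y _; have [n hn] := cube_quadrant dyadic x y 0.
  by exists n.
move=> n; have DQ := cubeD dyadic (0 - n%:Z) x; split.
  exact: cube_measurable DQ.
by case/andP: (cube_measure_bounds DQ).
Qed.

End CubeMeasure.

(** * Orthogonality to Haar functions and averages over cubes *)

Section HaarAverages.
Context {R : realType} {disp : measure_display} {X : measurableType disp}.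
Variables (d : X -> X -> R) (mu : {measure set X -> \bar R}).
Variables (D : int -> set (set X)) (nu a b : R) (h : set X -> nat -> X -> R).
Hypotheses (homogeneous : homogeneous_type d mu) (dyadic : dyadic_family d D).
Hypothesis scales : cube_scales d D nu a b.
Hypothesis haar : haar_system mu D h.
Local Notation cube := (cube D).

Let cube_meas j Q (DQ : D j Q) := cube_measurable homogeneous dyadic scales DQ.
Let cube_bounds j Q (DQ : D j Q) := cube_measure_bounds homogeneous dyadic
  scales DQ.
Let cube_fin j Q (DQ : D j Q) := cube_measure_fin homogeneous dyadic scales DQ.
Let cube_gt0 j Q (DQ : D j Q) := fine_cube_gt0 homogeneous dyadic scales DQ.

Lemma cube_indic_L2 j Q : D j Q -> L2 mu (\1_Q).
Proof.
by move=> DQ; apply: indic_L2;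
  [exact: cube_meas DQ|case/andP: (cube_bounds DQ)].
Qed.

Lemma children_finite j Q : D j Q -> finite_set (children D j Q).
Proof. by have [M hM] := dyadic_children dyadic => /hM[]. Qed.

(** Such a function is constant on each of finitely many measurable pieces, the complement of [Q]
    and its children, so a preimage is a union of pieces. *)
Lemma haar_space_measurable j Q (f : X -> R) : D j Q ->
  haar_space D j Q f -> measurable_fun setT f.
Proof.
move=> DQ [f0 fc] _ A mA; rewrite setTI.
pose S := [set P | (P = ~` Q \/ children D j Q P) /\ exists2 x, P x & A (f x)].
rewrite (_ : f @^-1` A = \bigcup_(P in S) P).
  apply: countable_bigcup_measurable.
    apply: (@sub_countable _ _ _ ([set ~` Q] `|` children D j Q)).
      by apply: subset_card_le => P [[->|cP] _]; [left|right].
    apply: finite_set_countable; rewrite finite_setU; split => //.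
    exact: children_finite.
  move=> P [[->|[DP _]] _]; last exact: cube_meas DP.
  by apply: measurableC; exact: cube_meas DQ.
apply/seteqP; split=> [x Ax|x [P [[->|cP] [y Py Ay]] Px]] /=.
- have [Qx|nQx] := pselect (Q x); last first.
    by exists (~` Q) => //; split; [left|exists x].
  have cP := cube_child_cover dyadic DQ Qx.
  exists (cube (j + 1) x); last exact: cube_self dyadic _ _.
  by split; [right|exists x => //; exact: cube_self dyadic _ _].
- by rewrite f0//; rewrite f0 in Ay.
- by have [c hc] := fc _ cP; rewrite hc//; rewrite hc in Ay.
Qed.

Lemma haar_basis_L2 j Q l : D j Q -> (1 < nchildren D j Q)%N ->
  (l < nchildren D j Q)%N -> L2 mu (haar_basis mu h Q l).
Proof.
move=> DQ n1 ln; have [V ort _] := haar DQ n1.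
apply/L2P; split; first exact: haar_space_measurable DQ (V l ln).
have := ort l l ln ln; rewrite eqxx /inner /Rintegral.
under eq_integral do rewrite -expr2.
(* Normalization says [fine I = 1]; an infinite [I] would have [fine I = 0], so [I] is finite. *)
set I := (\int[mu]_x _)%E.
have : (0 <= I)%E by apply: integral_ge0 => x _; rewrite lee_fin sqr_ge0.
case: I => [r _ _| _ /= /esym/eqP|//]; first exact: ltry.
by rewrite oner_eq0.
Qed.

(** Equality of the averages of [u] over [P] and [Q], cleared of denominators. The indicator of [P]
    expands in the Haar basis of [Q], and [u] sees only its component along the normalized indicator
    of [Q]. *)
Lemma haar_average j Q P (u : X -> R) : D j Q -> children D j Q P -> L2 mu u ->
  (forall l, (0 < l < nchildren D j Q)%N -> (1 < nchildren D j Q)%N ->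
     inner mu u (h Q l) = 0) ->
  inner mu u (\1_P) * fine (mu Q) = fine (mu P) * inner mu u (\1_Q).
Proof.
move=> DQ [DP PQ] hu ort0.
have [n1|n1] := ltnP 1 (nchildren D j Q); last first.
  (* With a single child there are no Haar functions; the child containing any given point of [Q]
     must then be [P]. *)
  suff -> : P = Q by rewrite mulrC.
  have fc := children_finite DQ.
  have Pc : P \in fset_set (children D j Q) by rewrite in_fset_set// inE.
  apply/seteqP; split => // x Qx.
  have Cc : cube (j + 1) x \in fset_set (children D j Q).
    by rewrite in_fset_set// inE; exact: (cube_child_cover dyadic DQ Qx).
  suff -> : P = cube (j + 1) x by exact: cube_self dyadic _ _.
  have n1' : nchildren D j Q = 1%N.
    apply/eqP; rewrite eqn_leq n1/=.
    by have [M hM] := dyadic_children dyadic; have [_ /andP[]] := hM _ _ DQ.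
  move: n1'; rewrite /nchildren => /eqP/cardfs1P[Z ZE].
  by move: Pc Cc; rewrite ZE => /fset1P -> /fset1P ->.
have [V ort sp] := haar DQ n1.
have PV : haar_space D j Q (\1_P : X -> R).
  split=> [x nQx|P' [DP' _]].
    by rewrite indicE memNset// => /PQ.
  have [y P'y] := cube_nonempty dyadic DP'.
  exists (\1_P y) => x P'x; rewrite !indicE; congr (nat_of_bool _)%:R.
  apply/idP/idP; rewrite !inE => Pz.
    by rewrite (cubeE dyadic DP Pz) -(cubeE dyadic DP' P'x).
  by rewrite (cubeE dyadic DP Pz) -(cubeE dyadic DP' P'y).
have [c cE] := sp _ PV.
have n0 : (0 < nchildren D j Q)%N by exact: ltnW.
have eL l : (l < nchildren D j Q)%N -> L2 mu (haar_basis mu h Q l).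
  exact: haar_basis_L2.
set q := fine (mu Q); have q0 : 0 < q := cube_gt0 DQ.
have e0E v : L2 mu v ->
    inner mu v (haar_basis mu h Q 0) = (Num.sqrt q)^-1 * inner mu v (\1_Q).
  by move=> hv; rewrite /haar_basis innerZr//; exact: cube_indic_L2 DQ.
have PL : L2 mu (\1_P) by exact: cube_indic_L2 DP.
have e0L := eL 0%N n0.
have uP : inner mu u (\1_P) = c 0%N * inner mu u (haar_basis mu h Q 0).
  rewrite [in LHS]cE (inner_sum c hu eL).2 (bigD1 (Ordinal n0))//= big1
    ?addr0//.
  move=> l; rewrite -val_eqE/= -lt0n => l0.
  rewrite -[X in inner _ _ X](_ : h Q l = _); last by case: (nat_of_ord l) l0.
  by rewrite ort0 ?mulr0// l0 ltn_ord.
have c0 : inner mu (haar_basis mu h Q 0) (\1_P) = c 0%N.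
  rewrite [in LHS]cE (inner_sum c e0L eL).2 (bigD1 (Ordinal n0))// big1 ?addr0.
    by rewrite (ort 0%N 0%N n0 n0) mulr1; exact: addr0.
  move=> l l0; rewrite (ort 0%N l n0 (ltn_ord l)).
  have -> : (0 == l :> nat)%N = false by rewrite eq_sym; exact/negbTE.
  exact: mulr0.
rewrite uP -c0 innerC !e0E// inner_indic;
  [|exact: cube_meas DP|exact: cube_meas DQ].
rewrite setIidl// -!mulrA; set I := inner _ _ _.
have sq : Num.sqrt q * Num.sqrt q = q by rewrite -expr2 sqr_sqrtr// ltW.
have s0 : Num.sqrt q != 0 by rewrite sqrtr_eq0 -ltNge.
by move: sq s0; set t := Num.sqrt q => <- t0; field.
Qed.

(** The ratio [I n / m n] is the same for all ancestors of the stopping cube, while Cauchy-Schwarz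
    gives [I n ^+ 2 <= inner mu u u * m n]. Hence [(I 0 / m 0) ^+ 2 * m n] stays bounded although
    [m n] is unbounded, so [I 0 = 0]. *)
Lemma orth_haar_zero_cube (u : X -> R) (lambda : R) (x : X) :
  mu [set x] = 0%E -> mu [set: X] = +oo%E -> 0 < lambda -> L2 mu u ->
  (forall f, haar_above mu D h lambda f -> L2 mu f -> inner mu u f = 0) ->
  exists j : int, (mu (cube j x) <= lambda%:E)%E /\ inner mu u (\1_(cube j x))
    = 0.
Proof.
move=> x0 xoo l0 hu ort.
have [j [jl jg]] := stopping_cube homogeneous dyadic scales x0 xoo l0.
exists j; split => //.
pose m n := fine (mu (cube (j - n%:Z) x)).
pose I n := inner mu u (\1_(cube (j - n%:Z) x)).
have Dn n : D (j - n%:Z) (cube (j - n%:Z) x) by exact: cubeD dyadic _ _.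
have m0 n : 0 < m n by exact: cube_gt0 (Dn n).
have succE n : j - n%:Z = j - n.+1%:Z + 1.
  by rewrite -addn1 PoszD opprD addrA subrK.
(* The Haar functions involved are those of the parent, index [n.+1], whose measure exceeds [lambda]
   even for [n = 0]. *)
have step n : I n * m n.+1 = m n * I n.+1.
  apply: (haar_average (Dn n.+1)) => //.
    split; first by rewrite -succE; exact: Dn.
    by rewrite succE; exact: cube_succ dyadic _ _.
  move=> l /andP[l1 l2] n1; apply: ort.
    exists (j - n.+1%:Z), (cube (j - n.+1%:Z) x), l; split => //.
    by rewrite l1 -ltnS prednK// (ltn_trans _ n1).
  rewrite (_ : h _ l = haar_basis mu h (cube (j - n.+1%:Z) x) l);
    last by case: l l1 {l2}.
  exact: haar_basis_L2 (Dn n.+1) n1 l2.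
have iter n : I 0%N * m n = m 0%N * I n.
  elim: n => [|n IH]; first exact: mulrC.
  apply: (mulfI (lt0r_neq0 (m0 n))).
  by rewrite mulrCA mulrA IH -mulrA step mulrCA.
have cs n : I n ^+ 2 <= inner mu u u * m n.
  apply: (le_trans (inner_cauchy_schwarz hu (cube_indic_L2 (Dn n)))).
  by rewrite inner_indic ?setIid//; exact: cube_meas (Dn n).
have I0E : I 0%N = inner mu u (\1_(cube j x)) by rewrite /I subr0.
rewrite -I0E; apply/eqP/negPn/negP => I00.
have bound n : I 0%N ^+ 2 * m n <= m 0%N ^+ 2 * inner mu u u.
  have mn := m0 n.
  rewrite -(ler_pM2r mn) -mulrA -expr2 -exprMn iter exprMn -[leRHS]mulrA.
  by rewrite ler_pM2l ?exprn_gt0//; exact: cs.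
have [n hn] := cube_measure_large homogeneous dyadic scales x j
  (m 0%N ^+ 2 * inner mu u u / I 0%N ^+ 2) xoo.
have I2 : 0 < I 0%N ^+ 2 by rewrite exprn_even_gt0.
move: hn; rewrite -(fineK (cube_fin (Dn n))) lte_fin ltr_pdivrMr// ltNge.
by rewrite [_ * I 0%N ^+ 2]mulrC bound.
Qed.

End HaarAverages.

(** * Countable suprema, and integral inequalities without measurability of the larger function *)

Section IntegralTools.
Context {R : realType} {disp : measure_display} {Y : measurableType disp}.

Lemma measurable_ereal_sup (I : Type) (A : set I) (f : I -> Y -> \bar R) :
  countable A -> (forall i, A i -> measurable_fun setT (f i)) ->
  measurable_fun setT (fun y => ereal_sup [set f i y | i in A]).
Proof.
move=> cA mf.
apply: (measurability _ (ErealGenOInfty.measurableE R)) => // _ [_ [r ->] <-].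
rewrite setTI (_ : _ @^-1` _ = \bigcup_(i in A) (f i @^-1` `]r%:E, +oo[)).
  apply: countable_bigcup_measurable => // i Ai.
  by rewrite -[X in measurable X]setTI; apply: mf => //; exact: emeasurable_itv.
apply/seteqP; split=> [y|y [i Ai]] /=; rewrite !in_itv/= !andbT.
  by move=> /ereal_sup_gt[_ [i Ai <-] h]; exists i => //=;
    rewrite in_itv/= andbT.
by move=> h; apply: (lt_le_trans h); apply: ereal_sup_ubound; exists i.
Qed.

Variable m : {measure set Y -> \bar R}.

(* The integral of a nonnegative function is a supremum over simple functions,
   hence monotone even when the functions are not measurable. *)
Lemma ge0_le_integralT (f g : Y -> \bar R) : (forall y, 0 <= f y)%E ->
  (forall y, f y <= g y)%E -> (\int[m]_y f y <= \int[m]_y g y)%E.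
Proof.
move=> f0 fg; rewrite !ge0_integralTE//; last first.
  by move=> y; exact: le_trans (f0 y) (fg y).
apply: le_ereal_sup => _ [s hs <-]; exists s => // y;
  exact: le_trans (hs y) (fg y).
Qed.

(** For a lower bound [f] that changes sign: [g] also dominates its positive part, and the negative
    part, having finite integral, is discarded. *)
Lemma integrable_le_ge0_integral (f g : Y -> \bar R) :
  m.-integrable setT f -> (forall y, 0 <= g y)%E -> (forall y, f y <= g y)%E ->
  (\int[m]_y f y <= \int[m]_y g y)%E.
Proof.
move=> fi g0 fg; rewrite integralE.
apply: (@le_trans _ _ (\int[m]_x f^\+ x)%E).
  rewrite leeBlDr; last first.
    exact: integrable_neg_fin_num.
  by rewrite leeDl// integral_ge0.
apply: ge0_le_integralT => // y.
by rewrite funeposE ge_max fg g0.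
Qed.

End IntegralTools.

(* The set function [mu] itself, carrying the sigma-finite structure under which
   [mu \x mu] is a measure. *)
Section SigmaFiniteCopy.
Context {R : realType} {disp : measure_display} {X : measurableType disp}.
Variables (mu : {measure set X -> \bar R}) (sf : sigma_finite [set: X] mu).

Definition sigma_finite_copy of sigma_finite [set: X] mu : set X -> \bar R :=
  mu.

HB.instance Definition _ := Measure.on (sigma_finite_copy sf).
HB.instance Definition _ :=
  Measure_isSigmaFinite.Build _ _ _ (sigma_finite_copy sf) sf.

End SigmaFiniteCopy.

(** * The measurable substitute for the energy, and its coercivity *)

Section DyadicEnergy.
Context {R : realType} {disp : measure_display} {X : measurableType disp}.
Variables (d : X -> X -> R) (mu : {measure set X -> \bar R}).
Variables (D : int -> set (set X)) (nu a b sigma : R).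
Hypotheses (homogeneous : homogeneous_type d mu) (dyadic : dyadic_family d D).
Hypothesis scales : cube_scales d D nu a b.
Hypothesis sigma0 : 0 < sigma.
Local Notation B := (qball d).
Local Notation cube := (cube D).
Local Notation s := (1 + 2 * sigma).
Implicit Types u v : X -> R.

Let nu0 : 0 < nu. Proof. by case/andP: (scale_nu scales). Qed.
Let nuj0 j : 0 < nu ^ j. Proof. exact: exprz_gt0. Qed.
Let s0 : 0 < s. Proof. by rewrite addr_gt0// mulr_gt0. Qed.

Definition near_pairs : set (int * (set X * set X)) :=
  [set i | [/\ D i.1 i.2.1, D i.1 i.2.2 &
     exists x y, [/\ i.2.1 x, i.2.2 y & d x y < nu ^ i.1]]].

Definition pair_term u (i : int * (set X * set X)) (z : X * X) : R :=
  \1_(i.2.1 `*` i.2.2) z * ((u z.1 - u z.2) ^+ 2 / fine (mu i.2.1) `^ s).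

(* Comparable with the integrand of [energy_d], but measurable: the function
   mu (B x (d x y)) need not be jointly measurable in (x, y), since only the
   sections of [d] are assumed measurable. *)
Definition pair_energy u (z : X * X) : \bar R :=
  ereal_sup [set (pair_term u i z)%:E | i in near_pairs].

Definition density u (z : X * X) : R :=
  `|u z.1 - u z.2| ^+ 2 / fine (mu (B z.1 (d z.1 z.2))) `^ s.

Lemma countable_near_pairs : countable near_pairs.
Proof.
apply: (@sub_countable _ _ _ (\bigcup_(j : int) \bigcup_(P in D j)
    \bigcup_(Q in D j) [set (j, (P, Q))])).
  apply: subset_card_le => -[j [P Q]] [/= DP DQ _].
  by exists j => //; exists P => //; exists Q.
apply: bigcup_countable => // j _.
apply: bigcup_countable; first exact: (countable_cubes dyadic).
move=> P _; apply: bigcup_countable; first exact: (countable_cubes dyadic).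
by move=> Q _; exact: countable1.
Qed.

Lemma near_pairs_cube j x y : d x y < nu ^ j ->
  near_pairs (j, (cube j x, cube j y)).
Proof.
move=> xy; split => /=; [exact: (cubeD dyadic)|exact: (cubeD dyadic)|].
by exists x, y; split => //; exact: (cube_self dyadic).
Qed.

Lemma pair_term_ge0 u i z : 0 <= pair_term u i z.
Proof. by rewrite mulr_ge0// divr_ge0// ?sqr_ge0// powR_ge0. Qed.

Lemma pair_energy_cube u j x y : d x y < nu ^ j ->
  ((((u x - u y) ^+ 2) / fine (mu (cube j x)) `^ s)%:E <= pair_energy u (x,
    y))%E.
Proof.
move=> xy; apply: ereal_sup_ubound; exists (j, (cube j x, cube j y)).
  exact: near_pairs_cube.
rewrite /pair_term/= indicE mem_set ?mul1r//.
by split; exact: (cube_self dyadic).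
Qed.

Local Lemma dxx x : d x x = 0.
Proof. by have [[_ _ d1 _] _ _] := homogeneous; rewrite (d1 x x).2. Qed.

Lemma pair_energy_ge0 u z : (0 <= pair_energy u z)%E.
Proof.
apply: (@le_trans _ _ (pair_term u (0, (cube 0 z.1, cube 0 z.1)) z)%:E).
  by rewrite lee_fin pair_term_ge0.
apply: ereal_sup_ubound; eexists; last by reflexivity.
by apply: near_pairs_cube; rewrite dxx.
Qed.

Lemma pair_energy_measurable u : measurable_fun setT u ->
  measurable_fun setT (pair_energy u).
Proof.
move=> mu_; apply: measurable_ereal_sup; first exact: countable_near_pairs.
move=> [j [P Q]] [/= DP DQ _]; apply/measurable_EFinP.
apply: measurable_funM.
  apply: measurable_indic; apply: measurableX.
    exact: (cube_measurable homogeneous dyadic scales DP).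
  exact: (cube_measurable homogeneous dyadic scales DQ).
apply: measurable_funM => //; apply: measurable_funX.
by apply: measurable_funB; apply: measurableT_comp.
Qed.

Local Lemma powR_div_le (p q C t : R) : 0 < p -> 0 < q -> 0 < C -> 0 <= t ->
  p <= C * q -> t / q `^ s <= C `^ s * (t / p `^ s).
Proof.
move=> p0 q0 C0 t0 pq.
rewrite mulrCA ler_wpM2l// -ler_pdivrMl ?powR_gt0// -invfM.
rewrite lef_pV2 ?posrE ?mulr_gt0 ?powR_gt0// -powRM ?(ltW C0) ?(ltW q0)//.
by apply: ge0_ler_powR => //;
  rewrite ?nnegrE ?mulr_ge0 ?(ltW s0) ?(ltW p0) ?(ltW C0) ?(ltW q0).
Qed.

Local Lemma d_gt0 x y : x <> y -> 0 < d x y.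
Proof.
move=> xy; have [[d0 _ d1 _] _ _] := homogeneous.
by rewrite lt_neqAle d0 andbT eq_sym; apply/eqP => /d1.
Qed.

Local Lemma ball_fin x r : 0 < r -> mu (B x r) \is a fin_num.
Proof.
by move=> /(qball_measure_bounds homogeneous x)/andP[h1 h2];
  rewrite ge0_fin_numE// ltW.
Qed.

Local Lemma ball_gt0 x r : 0 < r -> 0 < fine (mu (B x r)).
Proof. by move=> /(qball_measure_bounds homogeneous x); exact: fine_gt0. Qed.

Lemma pair_energy_le_density : exists2 C : R, 0 < C &
  forall u z, (pair_energy u z <= (C * density u z)%:E)%E.
Proof.
have [[d0 dC d1 [k k1 dT]] _ _] := homogeneous.
have k0 : 0 < k by rewrite (lt_le_trans ltr01).
(* Going from [x] to [x'] in [P], across to [y'], then to [y] in [Q] costs at most [a], [1] and [a]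
   times [nu ^ j], with a factor [k] for each use of the quasi-triangle inequality. *)
have [C C0 H] := qball_le_cube homogeneous dyadic scales (k * (a + k * (1 +
  a))).
exists (C `^ s); first exact: powR_gt0.
move=> u [x y]; apply: ge_ereal_sup => _ [[j [P Q]] [/= DP DQ [x' [y' [Px' Qy'
  xy']]]] <-].
rewrite lee_fin.
have rhs0 : 0 <= C `^ s * density u (x, y).
  by rewrite mulr_ge0 ?powR_ge0// divr_ge0 ?sqr_ge0 ?powR_ge0.
rewrite /pair_term /= indicE; case: (boolP (_ \in _)) => [|_];
  last by rewrite mul0r.
rewrite inE => -[/= Px Qy]; rewrite mul1r.
have [->|xy] := pselect (x = y).
  rewrite subrr expr0n/= mul0r mulr_ge0 ?powR_ge0//.
  by rewrite divr_ge0 ?sqr_ge0 ?powR_ge0.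
have dxy := d_gt0 xy.
rewrite /density/= real_normK ?num_real//.
apply: powR_div_le => //;
  [exact: ball_gt0|exact: (fine_cube_gt0 homogeneous dyadic scales DP)|
  exact: sqr_ge0|].
have Pfin := cube_measure_fin homogeneous dyadic scales DP.
rewrite -lee_fin EFinM (fineK Pfin) (fineK (ball_fin _ dxy)).
apply: le_trans (H _ _ _ DP Px).
apply: le_measure; rewrite ?inE; [exact: (qball_measurable homogeneous)..|].
apply: qballS; apply: (le_trans (dT _ _ x')); rewrite -mulrA ler_pM2l// mulrDl.
apply: lerD; first exact: (scale_diam scales DP Px Px').
apply: (le_trans (dT _ _ y')); rewrite -mulrA ler_pM2l// mulrDl mul1r.
by apply: lerD; [exact: ltW|exact: (scale_diam scales DQ Qy' Qy)].
Qed.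

Lemma density_le_pair_energy : exists2 C : R, 0 < C &
  forall u z, ((density u z)%:E <= C%:E * pair_energy u z)%E.
Proof.
have [C C0 H] := cube_le_qball homogeneous dyadic scales nu^-1.
exists (C `^ s); first exact: powR_gt0.
move=> u [x y].
have [->|xy] := pselect (x = y).
  rewrite /density/= subrr normr0 expr0n/= mul0r mule_ge0//.
    by rewrite lee_fin powR_ge0.
  exact: pair_energy_ge0.
have dxy := d_gt0 xy.
(* At this level the cubes of [x] and [y] form a near pair, and [nu ^ j <= nu^-1 * d x y], which is
   where the factor [nu^-1] above comes from. *)
have [j /andP[j1 j2]] := scale_exists (scale_nu scales) dxy.
have DP := cubeD dyadic j x; have Px := cube_self dyadic j x.
apply: (@le_trans _ _ ((C `^ s)%:E * ((u x - u y) ^+ 2 / fine (mu (cube j x))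
  `^ s)%:E)%E).
  rewrite -EFinM lee_fin /density/= real_normK ?num_real//.
  apply: powR_div_le => //;
    [exact: (fine_cube_gt0 homogeneous dyadic scales DP)|
    exact: ball_gt0|exact: sqr_ge0|].
  have Pfin := cube_measure_fin homogeneous dyadic scales DP.
  rewrite -lee_fin EFinM (fineK Pfin) (fineK (ball_fin _ dxy)).
  apply: (H _ _ _ _ DP Px dxy).
  by rewrite ler_pdivlMl// mulrC -[X in _ * X]expr1z -expfzDr// gt_eqF.
rewrite lee_pmul2l ?lte_fin ?powR_gt0//.
exact: pair_energy_cube.
Qed.

Lemma pair_energy_comb (c : R) u v z :
  (pair_energy (c \*o u \+ v)%R z <=
     (2 * c ^+ 2)%:E * pair_energy u z + 2%:E * pair_energy v z)%E.
Proof.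
apply: ge_ereal_sup => _ [i ni <-].
apply: (@le_trans _ _ ((2 * c ^+ 2)%:E * (pair_term u i z)%:E + 2%:E *
  (pair_term v i z)%:E)%E).
  rewrite -!EFinM -EFinD lee_fin /pair_term /=.
  set w := fine _ `^ s; set e := \1_(_) z.
  have t0 : 0 <= e / w by rewrite divr_ge0// powR_ge0.
  (* The two sides differ by exactly this square times [e / w]. *)
  have := mulr_ge0 t0 (sqr_ge0 (c * (u z.1 - u z.2) - (v z.1 - v z.2))).
  rewrite -subr_ge0 => h; rewrite -subr_ge0.
  by apply: (le_trans h); rewrite le_eqVlt; apply/orP; left; apply/eqP; ring.
have ub w : ((pair_term w i z)%:E <= pair_energy w z)%E.
  by apply: ereal_sup_ubound; exists i.
by apply: leeD; apply: lee_wpmul2l => //; rewrite lee_fin mulr_ge0 ?sqr_ge0.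
Qed.

Variable sf : sigma_finite [set: X] mu.
Local Notation m := (sigma_finite_copy sf).

Lemma energy_dE u : energy_d d mu sigma u = (\int[m \x m]_z (density u z)%:E)%E.
Proof. by []. Qed.

Lemma energy_d0 : energy_d d mu sigma (cst 0) = 0%E.
Proof.
rewrite energy_dE integral0_eq// => z _.
by rewrite /density/= subrr normr0 expr0n mul0r.
Qed.

Definition pair_integral u : \bar R := (\int[m \x m]_z pair_energy u z)%E.

(** The constant is pulled out of the integral of the measurable [pair_energy]; [density] enters
    only through monotonicity of the integral. *)
Lemma pair_integral_le_energy_d : exists2 c : R, 0 < c &
  forall u, measurable_fun setT u ->
    (c%:E * pair_integral u <= energy_d d mu sigma u)%E.
Proof.
have [C C0 H] := pair_energy_le_density.
exists C^-1; first by rewrite invr_gt0.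
move=> u mu_; rewrite energy_dE /pair_integral -ge0_integralZl_EFin//;
  last 3 first.
- by move=> z _; exact: pair_energy_ge0.
- exact: pair_energy_measurable.
- by rewrite invr_ge0 ltW.
apply: ge0_le_integralT => z.
  by rewrite mule_ge0 ?pair_energy_ge0// lee_fin invr_ge0 ltW.
by rewrite lee_pdivrMl// -EFinM.
Qed.

Lemma energy_d_le_pair_integral : exists2 C : R, 0 < C &
  forall u, measurable_fun setT u ->
    (energy_d d mu sigma u <= C%:E * pair_integral u)%E.
Proof.
have [C C0 H] := density_le_pair_energy.
exists C => // u mu_; rewrite energy_dE /pair_integral -ge0_integralZl_EFin//;
  last 3 first.
- by move=> z _; exact: pair_energy_ge0.
- exact: pair_energy_measurable.
- exact: ltW.
apply: ge0_le_integralT => // z.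
by rewrite lee_fin divr_ge0 ?sqr_ge0 ?powR_ge0.
Qed.

(** Additivity of the integral requires measurable integrands, so finiteness is carried over to
    [pair_integral], combined there, and carried back. *)
Lemma energy_d_comb_fin (c : R) u v :
  measurable_fun setT u -> measurable_fun setT v ->
  (energy_d d mu sigma u < +oo -> energy_d d mu sigma v < +oo ->
   energy_d d mu sigma (c \*o u \+ v)%R < +oo)%E.
Proof.
move=> mu_ mv.
have [C1 C10 H1] := pair_integral_le_energy_d.
have [C2 C20 H2] := energy_d_le_pair_integral.
have pfin w : measurable_fun setT w -> (energy_d d mu sigma w < +oo)%E ->
    (pair_integral w < +oo)%E.
  move=> mw fw; have := le_lt_trans (H1 _ mw) fw.
  case: (pair_integral w) => [r _||]//; first exact: ltry.
  by rewrite gt0_muley// lte_fin.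
move=> /(pfin _ mu_) fu /(pfin _ mv) fv.
have mw : measurable_fun setT (c \*o u \+ v).
  by apply: measurable_funD => //; exact: measurable_funM.
apply: (le_lt_trans (H2 _ mw)).
have pos w : (0 <= pair_integral w)%E.
  by apply: integral_ge0 => z _; exact: pair_energy_ge0.
have mZ k w : measurable_fun setT w ->
    measurable_fun setT (fun z => (k%:E * pair_energy w z)%E).
  by move=> hw; apply: measurable_funeM; exact: pair_energy_measurable.
have Zge0 k w z : 0 <= k -> (0 <= k%:E * pair_energy w z)%E.
  by move=> k0; rewrite mule_ge0 ?pair_energy_ge0// lee_fin.
have c20 : 0 <= 2 * c ^+ 2 by rewrite mulr_ge0// sqr_ge0.
have le : (pair_integral (c \*o u \+ v)%R <=
    (2 * c ^+ 2)%:E * pair_integral u + 2%:E * pair_integral v)%E.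
  rewrite /pair_integral -!ge0_integralZl_EFin//;
    try exact: pair_energy_measurable;
    try by move=> z _; exact: pair_energy_ge0.
  rewrite -ge0_integralD//; try exact: mZ; try by move=> z _; exact: Zge0.
  apply: ge0_le_integralT => z; first exact: pair_energy_ge0.
  exact: pair_energy_comb.
rewrite lte_mul_pinfty ?lee_fin ?(ltW C20)//.
apply: (le_lt_trans le); apply: lte_add_pinfty;
  by rewrite lte_mul_pinfty.
Qed.

Lemma pair_energy_section u (lambda : R) j x : 0 < lambda -> L2 mu u ->
  (mu (cube j x) <= lambda%:E)%E -> inner mu u (\1_(cube j x)) = 0 ->
  ((lambda `^ (- (2 * sigma)) * u x ^+ 2)%:E <=
    \int[mu]_y pair_energy u (x, y))%E.
Proof.
move=> l0 hu ml avg0.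
have DP := cubeD dyadic j x;
  have mP := cube_measurable homogeneous dyadic scales DP.
have PL : L2 mu (\1_(cube j x)).
  apply: indic_L2 => //.
  by case/andP: (cube_measure_bounds homogeneous dyadic scales DP).
set P := cube j x in ml avg0 DP mP PL *.
set q := fine (mu P);
  have q0 : 0 < q := fine_cube_gt0 homogeneous dyadic scales DP.
pose t := (q `^ s)^-1.
have t0 : 0 <= t by rewrite invr_ge0 powR_ge0.
(* On [P] this is [t * (u x ^+ 2 - 2 * u x * u y)], that is [t * (u x - u y) ^+ 2] without its term
   [t * u y ^+ 2]. The mean of [u] over [P] being 0, its integral over [P] is [t * u x ^+ 2 * q],
   where [t * q] is the power [- (2 * sigma)] of [q]. *)
pose w : X -> R := (- (2 * t * u x)) \*o u \+ ((t * u x ^+ 2) \*o \1_P \+ cst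
  0).
have w1L : L2 mu ((t * u x ^+ 2) \*o \1_P \+ cst 0).
  by apply: L2_comb => //; exact: L2_0.
have wL : L2 mu w by exact: L2_comb.
have wI := L2_mul_integrable wL PL.
have wE : inner mu w (\1_P) = t * u x ^+ 2 * q.
  rewrite inner_comb// avg0 mulr0 add0r inner_comb//; last exact: L2_0.
  rewrite inner_indic// setIid -/q [X in _ + X]inner_ae0 ?addr0//.
  exact: nearW.
apply: (@le_trans _ _ (inner mu w (\1_P))%:E).
  rewrite wE lee_fin [X in _ <= X](_ : _ = q `^ (- (2 * sigma)) * u x ^+ 2).
    rewrite ler_wpM2r ?sqr_ge0// !powRN lef_pV2 ?posrE ?powR_gt0//.
    apply: ge0_ler_powR; rewrite ?nnegrE ?(ltW q0) ?(ltW l0) ?mulr_ge0 ?(ltW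
      sigma0)//.
    by rewrite -lee_fin fineK//;
      exact: (cube_measure_fin homogeneous dyadic scales DP).
  rewrite mulrAC; congr (_ * _); rewrite /t powRN powRD ?gt_eqF ?implybT//.
  by rewrite powRr1 ?ltW// invfM mulrAC mulVf ?mul1r// gt_eqF.
rewrite /inner /Rintegral fineK; last exact: integrable_fin_num.
apply: integrable_le_ge0_integral => // y; first exact: pair_energy_ge0.
rewrite /w /= indicE; case: (boolP (y \in P)) => [|_]; last first.
  by rewrite mulr0; exact: pair_energy_ge0.
rewrite inE => Py; rewrite /= !mulr1 addr0.
apply: (@le_trans _ _ ((u x - u y) ^+ 2 / q `^ s)%:E).
  rewrite lee_fin -/t -subr_ge0.
  have := mulr_ge0 t0 (sqr_ge0 (u y)) => h; apply: (le_trans h).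
  by rewrite le_eqVlt; apply/orP; left; apply/eqP; rewrite /t; ring.
(* A cube is a neighbour of itself, as witnessed by [d x x = 0]. *)
apply: ereal_sup_ubound; exists (j, (P, P)).
  by split => //=; exists x, x; split; rewrite ?dxx//;
    exact: (cube_self dyadic).
rewrite /pair_term/= indicE mem_set ?mul1r//.
by split => //; exact: (cube_self dyadic).
Qed.

(** Tonelli reduces the claim to the section bound at each [x]. The level [j] is picked separately
    for every point, since only the resulting pointwise inequality is integrated. *)
Lemma pair_integral_coercive u (lambda : R) : 0 < lambda -> L2 mu u ->
  (forall x, exists j, (mu (cube j x) <= lambda%:E)%E /\
     inner mu u (\1_(cube j x)) = 0) ->
  ((lambda `^ (- (2 * sigma)))%:E * norm2 mu u ^+ 2 <= pair_integral u)%E.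
Proof.
move=> l0 hu H; have mu_ := L2_measurable hu.
have mG := pair_energy_measurable mu_.
rewrite norm2_sqr /pair_integral (fubini_tonelli1 _ mG); last first.
  by move=> z; exact: pair_energy_ge0.
rewrite -ge0_integralZl_EFin//; last 3 first.
- by move=> x _; rewrite lee_fin sqr_ge0.
- by apply/measurable_EFinP; exact: measurable_funX.
- exact: powR_ge0.
apply: ge0_le_integralT => x.
  by rewrite mule_ge0// lee_fin ?powR_ge0 ?sqr_ge0.
have [j [ml avg0]] := H x.
by rewrite -EFinM; apply: (pair_energy_section l0 hu ml avg0).
Qed.

End DyadicEnergy.

(** * Coercivity on the kernel of the projection, and that this kernel is a closed subspace *)

Theorem theorem4 (R : realType) (disp : measure_display)
    (X : measurableType disp) (d : X -> X -> R)
    (mu : {measure set X -> \bar R}) (D : int -> set (set X))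
    (h : set X -> nat -> X -> R) (sigma : R)
    (homogeneous : homogeneous_type d mu)
    (no_atoms : forall x : X, mu [set x] = 0%E)
    (infinite_mass : mu [set: X] = +oo%E)
    (dyadic : dyadic_family d D)
    (haar : haar_system mu D h)
    (sigma_gt0 : 0 < sigma) :
  forall lambda : R, 0 < lambda ->
    coercivity_space d mu sigma (H_d d mu sigma `&` KerPi mu D h lambda) /\
    (exists2 C : R, 0 < C &
       forall u : X -> R, H_delta mu D sigma u ->
         Pi mu D h lambda u = cst 0 %[ae mu] ->
         (C%:E * norm2 mu u ^+ 2 <= energy_d d mu sigma u)%E).
Proof.
move=> lambda lambda_gt0.
(* Infinite mass excludes the empty space; the point serves to derive sigma-finiteness. *)
have [x0] : exists x : X, True.
  apply: contrapT => /forallNP noX; move: infinite_mass.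
  rewrite (_ : [set: X] = set0) ?measure0//.
  by apply/seteqP; split => // x _; exact: (noX x).
move=> _; have qd : quasi_distance d by case: homogeneous.
have [nu [a [b scales]]] := dyadic_cube_scales qd dyadic.
have sf := cube_sigma_finite homogeneous dyadic scales x0.
pose S := closed_span mu (haar_above mu D h lambda).
have SL : S `<=` L2 mu by move=> v [].
have S0 : S (cst 0) by exact: closed_span0.
have PiP u : L2 mu u ->
    Pi mu D h lambda u = cst 0 %[ae mu] <-> (forall v, S v -> inner mu u v = 0).
  exact: orth_proj_eq0.
(* Stated for all of L^2, with infinite energy allowed, so that one constant serves both claims. *)
have [C C_gt0 coercive] : exists2 C : R, 0 < C &
    forall u, L2 mu u -> Pi mu D h lambda u = cst 0 %[ae mu] ->
      (C%:E * norm2 mu u ^+ 2 <= energy_d d mu sigma u)%E.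
  have [c c_gt0 H] :=
    pair_integral_le_energy_d homogeneous dyadic scales sigma_gt0 sf.
  exists (c * lambda `^ (- (2 * sigma))); first by rewrite mulr_gt0// powR_gt0.
  move=> u hu /(PiP _ hu) ort; apply: le_trans (H _ (L2_measurable hu)).
  rewrite EFinM -muleA lee_pmul2l ?lte_fin//.
  apply: (pair_integral_coercive homogeneous dyadic scales) => // x.
  apply: (orth_haar_zero_cube homogeneous dyadic scales haar) => // f Ff fL.
  by apply: ort; exact: closed_span_sub.
split; last by exists C => // u [hu _]; exact: coercive.
split.
- by move=> u [].
- split.
    split; first by split; [exact: L2_0|rewrite energy_d0].
    split; first exact: L2_0.
    apply/(PiP _ (L2_0 mu)) => v Sv; apply: inner_ae0 => //; first exact: nearW.
    exact/L2_measurable/SL.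
  move=> c u v [[hu eu] [_ /(PiP _ hu) ku]] [[hv ev] [_ /(PiP _ hv) kv]].
  have hw := L2_comb c hu hv.
  split; split => //.
    exact: (energy_d_comb_fin homogeneous dyadic scales sigma_gt0 sf c
      (L2_measurable hu) (L2_measurable hv) eu ev).
  apply/(PiP _ hw) => w Sw; rewrite inner_comb//; last exact: SL.
  by rewrite ku// kv// mulr0 addr0.
- move=> u_ u Vu [hu eu] cv; split; split => //.
  have hu_ n : L2 mu (u_ n) by case: (Vu n) => -[].
  apply/(PiP _ hu); apply: (orth_closed SL hu_ hu).
    by move=> n; have [_ [hn /(PiP _ hn)]] := Vu n.
  (* The norm of [H_d] dominates the L^2 norm, so convergence in the former implies convergence in
     the latter. *)
  apply: (squeeze_cvge _ (cvg_cst 0%E) cv); apply: nearW => n.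
  by rewrite Lnorm_ge0/= leeDl// poweR_ge0.
- by exists C => // u [[hu _] [_ ku]]; exact: coercive.
Qed.
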